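(* Let $\mathbb F$ be a field, let $\alpha$ and $\gamma$ be commuting $\mathbb F$-automorphisms of an $\mathbb F$-algebra $A$, let $u\in A$ be $\gamma$-normal, and let $T$ be the generalized Weyl algebra $T(A,\alpha,u)$. Then $T$ is simple if and only if (i) $A$ is $\alpha$-simple; (ii) $\alpha^{m}$ is outer (i.e. not an inner automorphism of $A$) for all $m\geq 1$; (iii) $u$ is regular in $A$; (iv) $uA+\alpha^{m}(u)A=A$ for all $m\geq 1$.
   Context: Rings are associative with $1$. An element $u\in A$ is $\gamma$-normal if $ua=\gamma(a)u$ for all $a\in A$ and $\gamma(u)=u$. An element is regular if it is neither a left nor a right zero-divisor. An ideal $I$ of $A$ is an $\alpha$-ideal if $\alpha(I)\subseteq I$; $A$ is $\alpha$-simple if $0$ and $A$ are its only $\alpha$-ideals. Put $\beta=\alpha^{-1}\gamma$. The generalized Weyl algebra $T(A,\alpha,u)$ is the ring extension of $A$ generated by $X$ and $Y$ subject to the relations $XY=u$, $YX=\alpha(u)$ and, for all $a\in A$, $Xa=\beta(a)X$ and $Ya=\alpha(a)Y$. Every element of $T$ is uniquely of the form $a+\sum_{i=1}^m b_iY^i+\sum_{j=1}^n c_jX^j$ with $a,b_i,c_j\in A$. The automorphism $\gamma$ is part of the data. *)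

(* Defs.v *)
From HB Require Import structures.
From mathcomp Require Import all_boot all_algebra.
From mathcomp Require Import boolp classical_sets.

Set Implicit Arguments.
Unset Strict Implicit.
Unset Printing Implicit Defensive.

Import GRing.Theory.
Local Open Scope ring_scope.
Local Open Scope classical_set_scope.
Local Open Scope quotient_scope.

Record algAut (F : fieldType) (A : algType F) := AlgAut {
  aut :> {lrmorphism A -> A};
  autV : A -> A;
  autK : cancel aut autV;
  autVK : cancel autV aut
}.

Section RingNotions.
Variable R : pzRingType.
Implicit Types (I : set R) (u a b : R).

Definition two_sided_ideal I : Prop :=
  [/\ I 0,
      forall a b, I a -> I b -> I (a - b)
    & forall a b, I b -> I (a * b) /\ I (b * a)].

Definition simple_ring : Prop :=
  1 <> 0 :> R /\
  forall I, two_sided_ideal I -> I = [set 0] \/ I = [set: R].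

Definition alpha_ideal (alpha : R -> R) I : Prop :=
  two_sided_ideal I /\ alpha @` I `<=` I.

Definition alpha_simple (alpha : R -> R) : Prop :=
  forall I, alpha_ideal alpha I -> I = [set 0] \/ I = [set: R].

Definition normal_elt (gamma : R -> R) u : Prop :=
  (forall a, u * a = gamma a * u) /\ gamma u = u.

Definition left_zero_divisor u : Prop := exists a, a <> 0 /\ u * a = 0.
Definition right_zero_divisor u : Prop := exists a, a <> 0 /\ a * u = 0.
Definition regular_elt u : Prop :=
  ~ left_zero_divisor u /\ ~ right_zero_divisor u.

(* A bare ring carries no unit predicate or inverse operation, so the inverse
   w of v is quantified explicitly. *)
Definition inner (phi : R -> R) : Prop :=
  exists v w, [/\ v * w = 1, w * v = 1 & forall a, phi a = v * a * w].

Definition outer (phi : R -> R) : Prop := ~ inner phi.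

Definition principal_right_ideal u : set R := [set u * a | a in [set: R]].

Definition ideal_sum (I J : set R) : set R :=
  [set x | exists a b, [/\ I a, J b & x = a + b]].

End RingNotions.

(* T(A, alpha, u) is presented by generators and relations: it is the quotient
   of the ring expressions in X, Y and the elements of A by the least
   congruence [gwa_eq] containing the ring axioms, the operations of A, and the
   four families of defining relations.  The normal form of elements of T, and
   in particular the injectivity of A -> T, is not built in. *)
Section GeneralizedWeylAlgebra.
Variables (F : fieldType) (A : algType F) (alpha gamma : algAut A) (u : A).

Definition gwa_beta (a : A) : A := autV alpha (gamma a).

Inductive gwa_term : Type :=
  | TConst of A
  | TX
  | TY
  | TAdd of gwa_term & gwa_term
  | TOpp of gwa_term
  | TMul of gwa_term & gwa_term.

HB.instance Definition _ := gen_eqMixin gwa_term.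
HB.instance Definition _ := gen_choiceMixin gwa_term.

Local Notation "s +t t" := (TAdd s t) (at level 50, left associativity).
Local Notation "s *t t" := (TMul s t) (at level 40, left associativity).

Inductive gwa_eq : gwa_term -> gwa_term -> Prop :=
  | gwa_eq_refl s : gwa_eq s s
  | gwa_eq_sym s t : gwa_eq s t -> gwa_eq t s
  | gwa_eq_trans s t r : gwa_eq s t -> gwa_eq t r -> gwa_eq s r
  | gwa_eq_congD s s' t t' :
      gwa_eq s s' -> gwa_eq t t' -> gwa_eq (s +t t) (s' +t t')
  | gwa_eq_congN s s' : gwa_eq s s' -> gwa_eq (TOpp s) (TOpp s')
  | gwa_eq_congM s s' t t' :
      gwa_eq s s' -> gwa_eq t t' -> gwa_eq (s *t t) (s' *t t')
  | gwa_eq_addA s t r : gwa_eq (s +t (t +t r)) (s +t t +t r)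
  | gwa_eq_addC s t : gwa_eq (s +t t) (t +t s)
  | gwa_eq_add0 s : gwa_eq (TConst 0 +t s) s
  | gwa_eq_addN s : gwa_eq (TOpp s +t s) (TConst 0)
  | gwa_eq_mulA s t r : gwa_eq (s *t (t *t r)) (s *t t *t r)
  | gwa_eq_mul1l s : gwa_eq (TConst 1 *t s) s
  | gwa_eq_mul1r s : gwa_eq (s *t TConst 1) s
  | gwa_eq_mulDl s t r : gwa_eq ((s +t t) *t r) (s *t r +t t *t r)
  | gwa_eq_mulDr s t r : gwa_eq (s *t (t +t r)) (s *t t +t s *t r)
  | gwa_eq_constD a b : gwa_eq (TConst (a + b)) (TConst a +t TConst b)
  | gwa_eq_constM a b : gwa_eq (TConst (a * b)) (TConst a *t TConst b)
  | gwa_eq_XY : gwa_eq (TX *t TY) (TConst u)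
  | gwa_eq_YX : gwa_eq (TY *t TX) (TConst (alpha u))
  | gwa_eq_Xa a : gwa_eq (TX *t TConst a) (TConst (gwa_beta a) *t TX)
  | gwa_eq_Ya a : gwa_eq (TY *t TConst a) (TConst (alpha a) *t TY).

Definition gwa_eqb : rel gwa_term := fun s t => `[< gwa_eq s t >].

Lemma gwa_eqb_refl : reflexive gwa_eqb.
Proof. by move=> s; apply/asboolP; exact: gwa_eq_refl. Qed.

Lemma gwa_eqb_sym : symmetric gwa_eqb.
Proof. by move=> s t; apply/asboolP/asboolP; exact: gwa_eq_sym. Qed.

Lemma gwa_eqb_trans : transitive gwa_eqb.
Proof.
by move=> t s r /asboolP st /asboolP tr; apply/asboolP; exact: gwa_eq_trans tr.
Qed.

Canonical gwa_equiv :=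
  EquivRel gwa_eqb gwa_eqb_refl gwa_eqb_sym gwa_eqb_trans.

Definition gwa : Type := {eq_quot gwa_equiv}.

HB.instance Definition _ := Choice.on gwa.
HB.instance Definition _ := Quotient.on gwa.

Lemma gwa_piP (s t : gwa_term) : \pi_gwa s = \pi_gwa t <-> gwa_eq s t.
Proof.
by split=> [/eqmodP/asboolP //|st]; apply/eqmodP/asboolP.
Qed.

Lemma gwa_repr (s : gwa_term) : gwa_eq (repr (\pi_gwa s)) s.
Proof. by apply/gwa_piP; rewrite reprK. Qed.

Definition gwa_zero : gwa := \pi_gwa (TConst 0).
Definition gwa_one : gwa := \pi_gwa (TConst 1).
Definition gwa_opp (x : gwa) : gwa := \pi_gwa (TOpp (repr x)).
Definition gwa_add (x y : gwa) : gwa := \pi_gwa (repr x +t repr y).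
Definition gwa_mul (x y : gwa) : gwa := \pi_gwa (repr x *t repr y).

Lemma gwa_piN s : \pi_gwa (TOpp s) = gwa_opp (\pi_gwa s).
Proof. by apply/gwa_piP/gwa_eq_congN/gwa_eq_sym/gwa_repr. Qed.

Lemma gwa_piD s t : \pi_gwa (s +t t) = gwa_add (\pi_gwa s) (\pi_gwa t).
Proof. by apply/gwa_piP/gwa_eq_congD; apply/gwa_eq_sym/gwa_repr. Qed.

Lemma gwa_piM s t : \pi_gwa (s *t t) = gwa_mul (\pi_gwa s) (\pi_gwa t).
Proof. by apply/gwa_piP/gwa_eq_congM; apply/gwa_eq_sym/gwa_repr. Qed.

Fact gwa_addrA : associative gwa_add.
Proof.
elim/quotW=> s; elim/quotW=> t; elim/quotW=> r.
by rewrite -(gwa_piD t r) -(gwa_piD s t) -!gwa_piD; apply/gwa_piP/gwa_eq_addA.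
Qed.

Fact gwa_addrC : commutative gwa_add.
Proof.
by elim/quotW=> s; elim/quotW=> t; rewrite -!gwa_piD; apply/gwa_piP/gwa_eq_addC.
Qed.

Fact gwa_add0r : left_id gwa_zero gwa_add.
Proof. by elim/quotW=> s; rewrite -gwa_piD; apply/gwa_piP/gwa_eq_add0. Qed.

Fact gwa_addNr : left_inverse gwa_zero gwa_opp gwa_add.
Proof.
by elim/quotW=> s; rewrite -gwa_piN -gwa_piD; apply/gwa_piP/gwa_eq_addN.
Qed.

Fact gwa_mulrA : associative gwa_mul.
Proof.
elim/quotW=> s; elim/quotW=> t; elim/quotW=> r.
by rewrite -(gwa_piM t r) -(gwa_piM s t) -!gwa_piM; apply/gwa_piP/gwa_eq_mulA.
Qed.

Fact gwa_mul1r : left_id gwa_one gwa_mul.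
Proof. by elim/quotW=> s; rewrite -gwa_piM; apply/gwa_piP/gwa_eq_mul1l. Qed.

Fact gwa_mulr1 : right_id gwa_one gwa_mul.
Proof. by elim/quotW=> s; rewrite -gwa_piM; apply/gwa_piP/gwa_eq_mul1r. Qed.

Fact gwa_mulrDl : left_distributive gwa_mul gwa_add.
Proof.
elim/quotW=> s; elim/quotW=> t; elim/quotW=> r.
by rewrite -(gwa_piD s t) -!gwa_piM -gwa_piD; apply/gwa_piP/gwa_eq_mulDl.
Qed.

Fact gwa_mulrDr : right_distributive gwa_mul gwa_add.
Proof.
elim/quotW=> s; elim/quotW=> t; elim/quotW=> r.
by rewrite -(gwa_piD t r) -!gwa_piM -gwa_piD; apply/gwa_piP/gwa_eq_mulDr.
Qed.

HB.instance Definition _ := GRing.isPzRing.Build gwa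
  gwa_addrA gwa_addrC gwa_add0r gwa_addNr
  gwa_mulrA gwa_mul1r gwa_mulr1 gwa_mulrDl gwa_mulrDr.

Definition gwa_const (a : A) : gwa := \pi_gwa (TConst a).
Definition gwa_X : gwa := \pi_gwa TX.
Definition gwa_Y : gwa := \pi_gwa TY.

Fact gwa_const_zmod_morphism : zmod_morphism gwa_const.
Proof.
have D : {morph gwa_const : a b / a + b}.
  by move=> a b; rewrite [RHS]/GRing.add /= -gwa_piD; apply/gwa_piP/gwa_eq_constD.
by move=> a b; apply/eqP; rewrite eq_sym subr_eq -D subrK.
Qed.

Fact gwa_const_monoid_morphism : monoid_morphism gwa_const.
Proof.
split=> // a b; rewrite [RHS]/GRing.mul /= -gwa_piM.
exact/gwa_piP/gwa_eq_constM.
Qed.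

HB.instance Definition _ :=
  GRing.isZmodMorphism.Build A gwa gwa_const gwa_const_zmod_morphism.
HB.instance Definition _ :=
  GRing.isMonoidMorphism.Build A gwa gwa_const gwa_const_monoid_morphism.

Definition gwa_relations (S : pzRingType) (f : A -> S) (x y : S) : Prop :=
  [/\ x * y = f u,
      y * x = f (alpha u),
      forall a, x * f a = f (gwa_beta a) * x
    & forall a, y * f a = f (alpha a) * y].

Lemma gwa_relationsP : gwa_relations gwa_const gwa_X gwa_Y.
Proof.
split=> [||a|a]; rewrite /GRing.mul /= -!gwa_piM; apply/gwa_piP.
- exact: gwa_eq_XY.
- exact: gwa_eq_YX.
- exact: gwa_eq_Xa.
- exact: gwa_eq_Ya.
Qed.

Section UniversalProperty.
Variables (S : pzRingType) (f : {rmorphism A -> S}) (x y : S).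
Hypothesis fxyP : gwa_relations f x y.

Fixpoint gwa_eval (t : gwa_term) : S :=
  match t with
  | TConst a => f a
  | TX => x
  | TY => y
  | TAdd t1 t2 => gwa_eval t1 + gwa_eval t2
  | TOpp t1 => - gwa_eval t1
  | TMul t1 t2 => gwa_eval t1 * gwa_eval t2
  end.

Lemma gwa_eval_eq s t : gwa_eq s t -> gwa_eval s = gwa_eval t.
Proof.
have [xy yx xa ya] := fxyP.
elim=> //= *; rewrite ?(rmorph0, rmorph1, rmorphD, rmorphM) //.
all: try by congruence.
- exact: addrA.
- exact: addrC.
- exact: add0r.
- exact: addNr.
- exact: mulrA.
- exact: mul1r.
- exact: mulr1.
- exact: mulrDl.
- exact: mulrDr.
Qed.

Definition gwa_lift (z : gwa) : S := gwa_eval (repr z).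

Lemma gwa_lift_pi t : gwa_lift (\pi_gwa t) = gwa_eval t.
Proof. exact/gwa_eval_eq/gwa_repr. Qed.

Fact gwa_lift_zmod_morphism : zmod_morphism gwa_lift.
Proof.
elim/quotW=> s; elim/quotW=> t.
by rewrite [X in gwa_lift X](_ : _ = \pi_gwa (s +t TOpp t)) ?gwa_lift_pi //
  gwa_piD gwa_piN.
Qed.

Fact gwa_lift_monoid_morphism : monoid_morphism gwa_lift.
Proof.
split; first by rewrite /GRing.one /= gwa_lift_pi /= rmorph1.
elim/quotW=> s; elim/quotW=> t.
by rewrite [X in gwa_lift X](_ : _ = \pi_gwa (s *t t)) ?gwa_lift_pi // gwa_piM.
Qed.

HB.instance Definition _ :=
  GRing.isZmodMorphism.Build gwa S gwa_lift gwa_lift_zmod_morphism.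
HB.instance Definition _ :=
  GRing.isMonoidMorphism.Build gwa S gwa_lift gwa_lift_monoid_morphism.

Lemma gwa_universal : exists g : {rmorphism gwa -> S},
  [/\ g \o gwa_const =1 f, g gwa_X = x & g gwa_Y = y] /\
  forall h : {rmorphism gwa -> S},
    [/\ h \o gwa_const =1 f, h gwa_X = x & h gwa_Y = y] -> h =1 g.
Proof.
exists gwa_lift; split; first by split=> [a||] /=; rewrite gwa_lift_pi.
move=> h [hc hX hY]; elim/quotW=> t; rewrite /= gwa_lift_pi.
elim: t => [a|||s IHs t IHt|s IHs|s IHs t IHt] //=.
- exact: hc.
- by rewrite gwa_piD -IHs -IHt -rmorphD.
- by rewrite gwa_piN -IHs -rmorphN.
- by rewrite gwa_piM -IHs -IHt -rmorphM.
Qed.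

End UniversalProperty.

End GeneralizedWeylAlgebra.

(* Main.v *)
(* Left multiplication on a free left A-module with basis the Y^n and X^n shows
   that these monomials are left independent in T over A, so that every t has
   coefficients [coef t n].

   If T is simple: for an ideal J of A, the t with all coefficients of degree 0
   of s t r in J form an ideal of T that does not contain 1 unless J does.  It
   contains J when J is stable under alpha and its inverse, and Y^m when
   J = uA + alpha^m(u)A; this gives (i) and (iv).  If ua = 0 (resp. au = 0),
   Ya (resp. aX) is killed by X on the left (resp. by Y on the right), and the
   elements killed by a power of X (resp. Y) form an ideal; this gives (iii).
   If alpha^m is inner, some N Y^(m^2) with N a unit is central, and
   1 + N Y^(m^2) is not invertible; this gives (ii).

   Conversely, (iii) makes Y left regular, so that a nonzero ideal I of T
   contains a nonzero polynomial in Y, hence a power of Y by (i) and (ii), and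
   (iv) brings Y^(k+1) in I down to Y^k in I. *)
Require Import Defs.
From mathcomp Require Import all_boot all_order all_algebra.
From mathcomp Require Import boolp classical_sets.

Import Order.TTheory GRing.Theory Num.Theory.
Local Open Scope ring_scope.
Local Open Scope classical_set_scope.

Set Implicit Arguments.
Unset Strict Implicit.
Unset Printing Implicit Defensive.

Lemma simple_ideal1 (R : pzRingType) (I : set R) (x : R) :
  simple_ring R -> two_sided_ideal I -> I x -> x <> 0 -> I 1.
Proof.
move=> [_ Rs] /Rs [->|-> //] /= x0 xN0.
by case: xN0.
Qed.

Lemma two_sided_ideal_opp (R : pzRingType) (I : set R) (x : R) :
  two_sided_ideal I -> I x -> I (- x).
Proof. by move=> [I0 IB _] Ix; rewrite -sub0r; apply: IB. Qed.

Lemma two_sided_ideal_add (R : pzRingType) (I : set R) (x y : R) :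
  two_sided_ideal I -> I x -> I y -> I (x + y).
Proof.
move=> Ii Ix Iy; rewrite -[y]opprK; case: (Ii) => _ IB _.
exact: IB Ix (two_sided_ideal_opp Ii Iy).
Qed.

Section GWA.
Variables (F : fieldType) (A : algType F) (alpha gamma : algAut A).
Hypothesis alpha_gamma : forall a : A, alpha (gamma a) = gamma (alpha a).
Variables (u : A) (u_normal : normal_elt gamma u).

Local Notation beta := (gwa_beta alpha gamma).
Local Notation T := (gwa alpha gamma u).
Local Notation "a %:C" := (gwa_const alpha gamma u a).
Local Notation X := (gwa_X alpha gamma u).
Local Notation Y := (gwa_Y alpha gamma u).
Local Notation alphaV := (autV alpha).

(* [rmorphM] and its kin leave a coercion path on which [autK] no longer
   rewrites, hence these specializations. *)
Lemma alphaB a b : alpha (a - b) = alpha a - alpha b.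
Proof. exact: rmorphB. Qed.

Lemma alphaD a b : alpha (a + b) = alpha a + alpha b.
Proof. exact: rmorphD. Qed.

Lemma alphaM a b : alpha (a * b) = alpha a * alpha b.
Proof. exact: rmorphM. Qed.

Lemma alpha0 : alpha 0 = 0.
Proof. exact: rmorph0. Qed.

Lemma alpha1 : alpha 1 = 1.
Proof. exact: rmorph1. Qed.

(** * The map [beta] and its relations with [alpha] and [gamma] *)

Lemma alpha_beta a : alpha (beta a) = gamma a.
Proof. exact: autVK. Qed.

Lemma beta_alpha a : beta (alpha a) = gamma a.
Proof. by rewrite /gwa_beta -alpha_gamma autK. Qed.

Lemma alphaVB a b : alphaV (a - b) = alphaV a - alphaV b.
Proof. by apply: (can_inj (autK alpha)); rewrite alphaB !autVK. Qed.

Lemma alphaVM a b : alphaV (a * b) = alphaV a * alphaV b.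
Proof. by apply: (can_inj (autK alpha)); rewrite alphaM !autVK. Qed.

Lemma betaB a b : beta (a - b) = beta a - beta b.
Proof. by rewrite /gwa_beta rmorphB alphaVB. Qed.

Lemma beta0 : beta 0 = 0.
Proof. by rewrite -{1}[0]subr0 betaB subrr. Qed.

Lemma betaN a : beta (- a) = - beta a.
Proof. by rewrite -sub0r betaB beta0 sub0r. Qed.

Lemma betaD a b : beta (a + b) = beta a + beta b.
Proof. by rewrite -[b in LHS]opprK betaB betaN opprK. Qed.

Lemma betaM a b : beta (a * b) = beta a * beta b.
Proof. by rewrite /gwa_beta rmorphM alphaVM. Qed.

Lemma beta1 : beta 1 = 1.
Proof. by rewrite /gwa_beta rmorph1 -[RHS](autK alpha) alpha1. Qed.

(** * The left action of T on coordinate functions *)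

Lemma alpha_normal a : alpha u * a = gamma a * alpha u.
Proof.
have [un _] := u_normal.
by rewrite -{1}[a](autVK alpha) -alphaM un alphaM alpha_gamma autVK.
Qed.

(* Left multiplication on T, in the coordinates of its expected left A-basis:
   index n >= 0 stands for Y^n, and index - n < 0 for X^n. *)
Fixpoint gwa_act (t : gwa_term A) (f : int -> A) : int -> A :=
  match t with
  | TConst a => fun n => a * f n
  | TX => fun n => beta (f (n + 1)) * (if (0 <= n)%R then u else 1)
  | TY => fun n => alpha (f (n - 1)) * (if (0 < n)%R then 1 else alpha u)
  | TAdd s t => fun n => gwa_act s f n + gwa_act t f n
  | TOpp t => fun n => - gwa_act t f n
  | TMul s t => gwa_act s (gwa_act t f)
  end.

(** Products act by composition, so the rule [gwa_eq_mulDr] requires each operator to be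
    additive. *)
Lemma gwa_actD t f g :
  gwa_act t (fun n => f n + g n) = fun n => gwa_act t f n + gwa_act t g n.
Proof.
elim: t f g => [a|||s IHs t IHt|s IHs|s IHs t IHt] f g; apply/funext => n /=.
- by rewrite mulrDr.
- by rewrite betaD mulrDl.
- by rewrite alphaD mulrDl.
- by rewrite IHs IHt addrACA.
- by rewrite IHs opprD.
- by rewrite IHt IHs.
Qed.

Lemma gwa_act_eq s t : gwa_eq alpha gamma u s t -> gwa_act s = gwa_act t.
Proof.
have [un gu] := u_normal.
elim=> /=.
- by [].
- by move=> ? ? _ ->.
- by move=> ? ? ? _ -> _ ->.
- by move=> ? ? ? ? _ -> _ ->.
- by move=> ? ? _ ->.
- by move=> ? ? ? ? _ -> _ ->.
- by move=> *; apply/funext => f; apply/funext => n; rewrite addrA.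
- by move=> *; apply/funext => f; apply/funext => n; rewrite addrC.
- by move=> *; apply/funext => f; apply/funext => n; rewrite mul0r add0r.
- by move=> *; apply/funext => f; apply/funext => n; rewrite mul0r addNr.
- by [].
- by move=> *; apply/funext => f; apply/funext => n; rewrite mul1r.
- move=> s'; apply/funext => f; congr gwa_act.
  by apply/funext => n; rewrite mul1r.
- by [].
- by move=> *; apply/funext => f; rewrite gwa_actD.
- by move=> *; apply/funext => f; apply/funext => n; rewrite mulrDl.
- by move=> *; apply/funext => f; apply/funext => n; rewrite mulrA.
- apply/funext => f; apply/funext => n.
  rewrite addrK betaM beta_alpha -mulrA ltzD1.
  by case: ifP => _; rewrite ?beta1 ?mul1r ?beta_alpha ?gu ?mulr1 un.
- apply/funext => f; apply/funext => n.
  rewrite subrK alphaM alpha_beta -mulrA subr_ge0 -gtz0_ge1.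
  by case: ifP => _; rewrite ?alpha1 ?mul1r ?mulr1 alpha_normal.
- by move=> a; apply/funext => f; apply/funext => n; rewrite betaM mulrA.
- by move=> a; apply/funext => f; apply/funext => n; rewrite alphaM mulrA.
Qed.

(** The function fed to the action is the basis vector of index 0, which stands for 1, so these are
    the coordinates of [t * 1]. *)
Definition coef (t : T) (n : int) : A :=
  gwa_act (repr t) (fun k => (k == 0)%:R) n.

Lemma gwa_act_repr s : gwa_act (repr (\pi_T%qT s)) = gwa_act s.
Proof. exact/gwa_act_eq/gwa_repr. Qed.

Lemma coefM s t n : coef (s * t) n = gwa_act (repr s) (coef t) n.
Proof. by rewrite /coef /GRing.mul /= /gwa_mul gwa_act_repr. Qed.

Lemma coefD s t n : coef (s + t) n = coef s n + coef t n.
Proof. by rewrite /coef /GRing.add /= /gwa_add gwa_act_repr. Qed.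

Lemma coef1 n : coef 1 n = (n == 0)%:R.
Proof. by rewrite /coef /GRing.one /= /gwa_one gwa_act_repr /= mul1r. Qed.

Lemma coef0 n : coef 0 n = 0.
Proof. by rewrite /coef /GRing.zero /= /gwa_zero gwa_act_repr /= mul0r. Qed.

Lemma coefB s t n : coef (s - t) n = coef s n - coef t n.
Proof. by rewrite -[in RHS](subrK t s) (coefD (s - t) t) addrK. Qed.

Lemma coefCM a t n : coef (a%:C * t) n = a * coef t n.
Proof. by rewrite coefM /gwa_const gwa_act_repr. Qed.

Lemma coefYM t n :
  coef (Y * t) n = alpha (coef t (n - 1)) * (if (0 < n)%R then 1 else alpha u).
Proof. by rewrite coefM /gwa_Y gwa_act_repr. Qed.

Lemma coefXM t n :
  coef (X * t) n = beta (coef t (n + 1)) * (if (0 <= n)%R then u else 1).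
Proof. by rewrite coefM /gwa_X gwa_act_repr. Qed.

Lemma coefC a n : coef a%:C n = if n == 0 then a else 0.
Proof.
by rewrite -[a%:C]mulr1 coefCM coef1; case: eqP; rewrite ?mulr1 ?mulr0.
Qed.

Lemma constD a b : (a + b)%:C = a%:C + b%:C.
Proof. exact: rmorphD. Qed.

Lemma constB a b : (a - b)%:C = a%:C - b%:C.
Proof. exact: rmorphB. Qed.

Lemma constM a b : (a * b)%:C = a%:C * b%:C.
Proof. exact: rmorphM. Qed.

Lemma const0 : 0%:C = 0.
Proof. exact: rmorph0. Qed.

Lemma const1 : 1%:C = 1.
Proof. exact: rmorph1. Qed.

(** * Defining relations, monomials and normal forms *)

Lemma XY : X * Y = u%:C.
Proof. by have [] := gwa_relationsP alpha gamma u. Qed.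

Lemma YX : Y * X = (alpha u)%:C.
Proof. by have [] := gwa_relationsP alpha gamma u. Qed.

Lemma XC a : X * a%:C = (beta a)%:C * X.
Proof. by have [] := gwa_relationsP alpha gamma u. Qed.

Lemma YC a : Y * a%:C = (alpha a)%:C * Y.
Proof. by have [] := gwa_relationsP alpha gamma u. Qed.

Lemma YnC n a : Y ^+ n * a%:C = (iter n alpha a)%:C * Y ^+ n.
Proof.
elim: n a => [|n IHn] a; first by rewrite expr0 mulr1 mul1r.
by rewrite exprSr -mulrA YC mulrA IHn -mulrA iterSr.
Qed.

Lemma XnC n a : X ^+ n * a%:C = (iter n beta a)%:C * X ^+ n.
Proof.
elim: n a => [|n IHn] a; first by rewrite expr0 mulr1 mul1r.
by rewrite exprSr -mulrA XC mulrA IHn -mulrA iterSr.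
Qed.

Definition gmon (n : int) : T :=
  match n with Posz k => Y ^+ k | Negz k => X ^+ k.+1 end.

Lemma gwa_gen_ind (P : T -> Prop) :
    (forall a, P a%:C) -> P X -> P Y ->
    (forall s t, P s -> P t -> P (s + t)) ->
    (forall s t, P s -> P t -> P (s * t)) ->
  forall t, P t.
Proof.
move=> PC PX PY PD PM; elim/quotW; elim=> [a|||s IHs t IHt|s IHs|s IHs t IHt].
- exact: PC.
- exact: PX.
- exact: PY.
- by rewrite [X in P X](gwa_piD alpha gamma u s t); apply: PD.
- rewrite [X in P X](gwa_piN alpha gamma u s).
  rewrite (_ : gwa_opp _ = (-1)%:C * \pi_T%qT s); first exact: PM.
  by rewrite rmorphN1 mulN1r.
- by rewrite [X in P X](gwa_piM alpha gamma u s t); apply: PM.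
Qed.

(** The left A-span of the monomials contains 1 and is stable under left multiplication by
    constants, X and Y, hence is all of T. *)
Lemma gwa_mon_ind (P : T -> Prop) :
    (forall a n, P (a%:C * gmon n)) ->
    (forall s t, P s -> P t -> P (s + t)) ->
  forall t, P t.
Proof.
move=> Pm PD.
(* The impredicative encoding lets membership in the span be eliminated into any predicate, such as
   [fun r => span (X * r)]. *)
pose span t := forall Q : T -> Prop, (forall a n, Q (a%:C * gmon n)) ->
  (forall s t, Q s -> Q t -> Q (s + t)) -> Q t.
have spanD s t : span s -> span t -> span (s + t).
  by move=> ss st Q Qm QD; apply: (QD); [apply: ss | apply: st].
have spanM a n : span (a%:C * gmon n) by move=> Q Qm _; exact: Qm.
suff ML t : forall s, span s -> span (t * s).
  move=> t; have : span (t * (1%:C * gmon 0)) by apply: ML.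
  by rewrite const1 /= expr0 !mulr1 => tT; exact: tT.
elim/gwa_gen_ind: t => [b|||s t IHs IHt|s t IHs IHt] r sr.
- apply: (sr (fun r => span (b%:C * r))) => [a n|s t ss st].
    by rewrite mulrA -constM; apply: spanM.
  by rewrite mulrDr; apply: spanD.
- apply: (sr (fun r => span (X * r))) => [a n|s t ss st]; last first.
    by rewrite mulrDr; apply: spanD.
  rewrite mulrA XC -mulrA; case: n => [[|n]|n].
  + by rewrite /= expr0 mulr1; apply: (spanM _ (Negz 0)).
  + by rewrite /= exprS (mulrA X) XY mulrA -constM; apply: (spanM _ (Posz n)).
  + by rewrite /= -exprS; apply: (spanM _ (Negz n.+1)).
- apply: (sr (fun r => span (Y * r))) => [a n|s t ss st]; last first.
    by rewrite mulrDr; apply: spanD.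
  rewrite mulrA YC -mulrA; case: n => [n|[|n]].
  + by rewrite /= -exprS; apply: (spanM _ (Posz n.+1)).
  + by rewrite /= expr1 YX -constM -[_%:C]mulr1; apply: (spanM _ (Posz 0)).
  + by rewrite /= exprS (mulrA Y) YX mulrA -constM; apply: (spanM _ (Negz n)).
- by rewrite mulrDl; apply: spanD; auto.
- by rewrite -mulrA; auto.
Qed.

Lemma coef_gmon n m : coef (gmon n) m = (m == n)%:R.
Proof.
case: n => n /=.
  elim: n m => [|n IHn] m; first by rewrite expr0 coef1.
  rewrite exprS coefYM IHn subr_eq -PoszD addn1.
  by case: eqP => [->|_]; rewrite ?alpha1 ?alpha0 ?mul1r ?mul0r.
have IH k : coef (X ^+ k) m = (m == - k%:Z)%:R.
  elim: k m => [|k IHk] m; first by rewrite expr0 coef1.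
  rewrite exprS coefXM IHk -subr_eq0 opprK -addrA -PoszD add1n addr_eq0.
  by case: eqP => [->|_]; rewrite ?beta1 ?beta0 ?mul1r ?mul0r.
by rewrite IH NegzE.
Qed.

Lemma coef_Cgmon a n m : coef (a%:C * gmon n) m = if m == n then a else 0.
Proof. by rewrite coefCM coef_gmon; case: eqP; rewrite ?mulr1 ?mulr0. Qed.

(** Allowing every [M] beyond [N] lets the expansions of two summands be taken with the same
    length. *)
Lemma gwa_expansion t : exists N, forall M, (N <= M)%N ->
  t = \sum_(k < M) ((coef t (Posz k))%:C * Y ^+ k +
                    (coef t (Negz k))%:C * X ^+ k.+1).
Proof.
elim/gwa_mon_ind: t => [a n|s t [N1 e1] [N2 e2]]; last first.
  exists (maxn N1 N2) => M; rewrite geq_max => /andP[h1 h2].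
  rewrite {1}(e1 _ h1) {1}(e2 _ h2) -big_split /=; apply: eq_bigr => k _.
  by rewrite !coefD !constD !mulrDl addrACA.
have ae k : coef (a%:C * gmon n) k = if k == n then a else 0.
  exact: coef_Cgmon.
move te: (a%:C * gmon n) ae => t ae.
case: n te ae => n te ae; exists n.+1 => M nM; rewrite (bigD1 (Ordinal nM)) //=;
    rewrite big1 ?addr0 => [|k kn].
- by rewrite !ae eqxx const0 mul0r addr0 -te.
- by rewrite !ae (negPf kn : (Posz k == Posz n) = false) const0 !mul0r addr0.
- by rewrite !ae eqxx const0 mul0r add0r -te.
- by rewrite !ae (negPf kn : (Negz k == Negz n) = false) const0 !mul0r addr0.
Qed.

Lemma coef_eq0 t : (forall n, coef t n = 0) -> t = 0.
Proof.
move=> t0; have [N /(_ N (leqnn _)) ->] := gwa_expansion t.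
by rewrite big1 // => k _; rewrite !t0 const0 !mul0r addr0.
Qed.

Lemma coef_finite t : exists N : nat, forall k, (N <= k)%N ->
  coef t (Posz k) = 0 /\ coef t (Negz k) = 0.
Proof.
elim/gwa_mon_ind: t => [a n|s t [N1 e1] [N2 e2]]; last first.
  exists (maxn N1 N2) => k; rewrite geq_max !coefD => /andP[h1 h2].
  by have [-> ->] := e1 k h1; have [-> ->] := e2 k h2; rewrite addr0.
exists (absz n).+1 => k nk; rewrite !coef_Cgmon.
case: n nk => n nk; split=> //; case: eqP => // -[] kn.
  by move: nk; rewrite kn absz_nat ltnn.
by move: nk; rewrite kn /= ltnNge leqnSn.
Qed.

(** A constant crosses a monomial at the price of a twist, and the twist is trivial in degree 0. *)
Lemma coefMC0 t a : coef (t * a%:C) 0 = coef t 0 * a.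
Proof.
elim/gwa_mon_ind: t => [b n|s t IHs IHt]; last first.
  by rewrite mulrDl !coefD IHs IHt mulrDl.
suff [c [e c0]]: exists c, gmon n * a%:C = c%:C * gmon n /\ (n = 0 -> c = a).
  rewrite -mulrA e mulrA -constM !coef_Cgmon.
  by case: eqP => [/esym/c0 ->|_]; rewrite ?mul0r.
case: n => n.
  by exists (iter n alpha a); split; [exact: YnC | case=> ->].
by exists (iter n.+1 beta a); split; [exact: XnC | ].
Qed.

(** From a nonnegative index, Y only shifts and twists; no factor [alpha u] appears. *)
Lemma coefYnM_ge p t k :
  coef (Y ^+ p * t) (Posz (k + p)) = iter p alpha (coef t (Posz k)).
Proof.
elim: p => [|p IHp]; first by rewrite expr0 mul1r addn0.
by rewrite exprS -mulrA coefYM addnS -addn1 PoszD addrK IHp ltz_nat addn1 mulr1.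
Qed.

(** The witness [w] collects the factors coming from [alpha u] that arise when Y meets powers of
    X. *)
Lemma coefYnM p t n :
  exists w, coef (Y ^+ p * t) n = iter p alpha (coef t (n - p%:Z)) * w.
Proof.
elim: p n => [|p IHp] n.
  by exists 1; rewrite expr0 mul1r subr0 mulr1.
have [w e] := IHp (n - 1); rewrite exprS -mulrA coefYM e alphaM -mulrA.
by rewrite -[p.+1]add1n PoszD opprD addrA; eexists; reflexivity.
Qed.

Lemma iter_alphaB n a b :
  iter n alpha (a - b) = iter n alpha a - iter n alpha b.
Proof. by elim: n => //= n ->; rewrite alphaB. Qed.

Lemma iter_alphaM n a b :
  iter n alpha (a * b) = iter n alpha a * iter n alpha b.
Proof. by elim: n => //= n ->; rewrite alphaM. Qed.

Lemma iter_alpha0 n : iter n alpha 0 = 0.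
Proof. by elim: n => //= n ->; rewrite alpha0. Qed.

Lemma iter_alpha1 n : iter n alpha 1 = 1.
Proof. by elim: n => //= n ->; rewrite alpha1. Qed.

Lemma iter_alphaAC n p (a : A) :
  iter n alpha (iter p alpha a) = iter p alpha (iter n alpha a).
Proof. by rewrite -!iterD addnC. Qed.

Lemma iter_alphaVK n a : iter n alpha (iter n alphaV a) = a.
Proof. by elim: n => // n IHn; rewrite iterSr [iter n.+1 _ a]iterS autVK. Qed.

(** * Necessity: consequences of the simplicity of T *)

Lemma gwa_1_neq_0 : 1 <> 0 :> T.
Proof.
by move=> /(congr1 (coef^~ 0)); rewrite coef1 coef0 => /eqP; rewrite oner_eq0.
Qed.

Lemma gwa_two_sided (I : set T) :
    I 0 -> (forall s t, I s -> I t -> I (s - t)) ->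
    (forall a t, I t -> I (a%:C * t) /\ I (t * a%:C)) ->
    (forall t, I t -> I (X * t) /\ I (t * X)) ->
    (forall t, I t -> I (Y * t) /\ I (t * Y)) ->
  two_sided_ideal I.
Proof.
move=> I0 IB IC IX IY; split=> // s.
have ID x y : I x -> I y -> I (x + y).
  move=> Ix Iy; rewrite -[y]opprK; apply: (IB) => //.
  by rewrite -sub0r; apply: IB.
elim/gwa_gen_ind: s => [a|||s t IHs IHt|s t IHs IHt] r Ir; auto.
  have [? ?] := IHs _ Ir; have [? ?] := IHt _ Ir.
  by rewrite mulrDl mulrDr; split; apply: ID.
have [_ ?] := IHs _ Ir; have [? _] := IHt _ Ir.
split; first by rewrite -mulrA; apply: (IHs _ _).1.
by rewrite mulrA; apply: (IHt _ _).2.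
Qed.

Lemma coef0_ideal (J : set A) : two_sided_ideal J ->
  two_sided_ideal [set t : T | forall s r, J (coef (s * t * r) 0)].
Proof.
move=> [J0 JB JM]; split=> /= [s r|x y Jx Jy s r|x y Jy].
- by rewrite mulr0 mul0r coef0.
- by rewrite mulrBr mulrBl coefB; apply: JB.
- by split=> s r; [rewrite mulrA | rewrite mulrA -mulrA].
Qed.

Lemma alpha_simple_of_simple : simple_ring T -> alpha_simple alpha.
Proof.
move=> Ts I [Ii Ia]; have [I0 IB IM] := Ii.
have [[x [Ix xN0]]|Iz] := pselect (exists x, I x /\ x <> 0); last first.
  left; apply/seteqP; split=> [x Ix|x ->] //=.
  by apply: contrapT => xN0; apply: Iz; exists x.
(* An alpha-ideal need not be stable under the inverse of [alpha]. The union [J] of the preimages of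
   [I] is stable under both, and 1 in [J] still gives 1 in [I]. *)
right; pose J : set A := [set a | exists n, I (iter n alpha a)].
have Iiter n a : I a -> I (iter n alpha a).
  elim: n => //= n IHn /IHn In; apply: Ia.
  by exists (iter n alpha a).
have Ji : two_sided_ideal J.
  split=> [|a b [n In] [m Im]|a b [n In]]; first by exists 0%N.
    exists (m + n)%N; rewrite iter_alphaB; apply: IB.
      by rewrite iterD; apply: Iiter.
    by rewrite addnC iterD; apply: Iiter.
  by split; exists n; rewrite iter_alphaM;
    [apply: (IM _ _ _).1|apply: (IM _ _ _).2].
have Jalpha n a : J a -> J (iter n alpha a).
  move=> [m Im]; exists m; rewrite -iterD addnC iterD; exact: Iiter.
have JalphaV n a : J a -> J (iter n alphaV a).
  move=> [m Im]; exists (m + n)%N; by rewrite iterD iter_alphaVK.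
have [J0 JB JM] := Ji.
have JD a b : J a -> J b -> J (a + b) by exact: two_sided_ideal_add.
have Jx : J x by exists 0%N.
have Kx s r : J (coef (s * x%:C * r) 0).
  elim/gwa_mon_ind: s => [b n|s t IHs IHt]; last first.
    by rewrite !mulrDl coefD; apply: JD.
  elim/gwa_mon_ind: r => [c m|s t IHs IHt]; last first.
    by rewrite mulrDr coefD; apply: JD.
  rewrite -!mulrA coefCM (mulrA x%:C) -constM; apply: (JM _ _ _).1.
  have := (JM c _ Jx).2; move: (x * c) => y Jy.
  (* If either monomial is a power of Y, [y] crosses it under an iterate of [alpha] or its inverse,
     and stays in [J]. Between two powers of X the twist is by [beta], which is not controlled on
     [J], but the coefficient of degree 0 is then zero. *)
  case: n => n /=.
    by rewrite mulrA YnC -mulrA coefCM; apply: (JM _ _ _).2; apply: Jalpha.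
  case: m => m /=.
    rewrite -[y](iter_alphaVK m) -YnC mulrA coefMC0.
    by apply: (JM _ _ _).1; apply: JalphaV.
  by rewrite mulrA XnC -mulrA -exprD coefCM addSn (coef_gmon (Negz _)) mulr0.
have xN0T : x%:C <> 0.
  by move=> /(congr1 (coef^~ 0)); rewrite coefC coef0.
have /(_ 1 1) := simple_ideal1 Ts (coef0_ideal Ji) Kx xN0T.
rewrite !mulr1 coef1 => -[n]; rewrite iter_alpha1 => I1.
by apply/seteqP; split=> // a _; rewrite -[a]mulr1; apply: (IM _ _ _).1.
Qed.

Lemma comaximal_of_simple : simple_ring T -> forall m : nat, (1 <= m)%N ->
  ideal_sum (principal_right_ideal u)
            (principal_right_ideal (iter m alpha u)) = [set: A].
Proof.
move=> Ts m m0; set M := ideal_sum _ _.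
have [un _] := u_normal.
have gammaK a : exists b, gamma b = a by exists (autV gamma a); exact: autVK.
(* Both generators twist by the surjective map [gamma], which makes the right ideal [M]
   two-sided. *)
have umn a : iter m alpha u * a = gamma a * iter m alpha u.
  elim: m {m0 M} a => [|m IHm] a /=; first exact: un.
  by rewrite -{1}[a](autVK alpha) -alphaM IHm alphaM alpha_gamma autVK.
have Mi : two_sided_ideal M.
  split=> [|a b|a b].
  - exists 0, 0; split; rewrite ?addr0 //; exists 0 => //; exact: mulr0.
  - move=> [_ [_ [[a1 _ <-] [a2 _ <-] ->]]] [_ [_ [[b1 _ <-] [b2 _ <-] ->]]].
    exists (u * (a1 - b1)), (iter m alpha u * (a2 - b2)).
    split; [by exists (a1 - b1)|by exists (a2 - b2)|].
    by rewrite !mulrBr opprD addrACA.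
  - move=> [_ [_ [[b1 _ <-] [b2 _ <-] ->]]].
    have [c <-] := gammaK a; split.
      exists (u * (c * b1)), (iter m alpha u * (c * b2)).
      split; [by exists (c * b1)|by exists (c * b2)|].
      by rewrite mulrDr !mulrA un umn.
    exists (u * (b1 * gamma c)), (iter m alpha u * (b2 * gamma c)).
    split; [by exists (b1 * gamma c)|by exists (b2 * gamma c)|].
    by rewrite mulrDl !mulrA.
have [M0 MB MM] := Mi.
have Mu : M u.
  exists u, 0; split; rewrite ?addr0 //; [exists 1|exists 0] => //.
    exact: mulr1.
  exact: mulr0.
have Mum : M (iter m alpha u).
  exists 0, (iter m alpha u).
  split; rewrite ?add0r //; [exists 0|exists 1] => //.
    exact: mulr0.
  exact: mulr1.
have KY s r : M (coef (s * Y ^+ m * r) 0).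
  elim/gwa_mon_ind: s => [b n|s t IHs IHt]; last first.
    by rewrite !mulrDl coefD; apply: two_sided_ideal_add.
  rewrite -!mulrA coefCM; apply: (MM _ _ _).1; case: n => n /=.
    rewrite mulrA -exprD addnC exprD -mulrA; move: (_ * r) => t.
    (* Write [m = k.+1]. The first Y to act contributes [alpha u], as it lands at index [- k], and
       the other [k] turn this into [iter m alpha u]. *)
    have [k mE] : exists k, m = k.+1 by exists m.-1; rewrite prednK.
    rewrite mE iterSr in Mum.
    rewrite mE exprSr -mulrA; have [w ->] := coefYnM k (Y * t) 0.
    apply: (MM _ _ _).2; rewrite coefYM sub0r ifF ?iter_alphaM; last first.
      by rewrite oppr_gt0.
    by apply: (MM _ _ _).1.
  (* The last X lands at index 0 and leaves [u] as a right factor. *)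
  by rewrite exprS -mulrA coefXM /=; apply: (MM _ _ _).1.
have YN0 : Y ^+ m <> 0.
  move=> /(congr1 (coef^~ (Posz m))); rewrite (coef_gmon (Posz m)) eqxx coef0.
  by move/eqP; rewrite oner_eq0.
have /(_ 1 1) := simple_ideal1 Ts (coef0_ideal Mi) KY YN0.
rewrite !mulr1 coef1 /= => M1.
by apply/seteqP; split=> // a _; rewrite -[a]mulr1; apply: (MM _ _ _).1.
Qed.

Lemma regular_of_simple : simple_ring T -> regular_elt u.
Proof.
move=> Ts; split.
  move=> [a [aN0 ua0]].
  pose S : set T := [set t | exists n, X ^+ n * t = 0].
  have SX n t : X ^+ n * t = 0 -> forall m, X ^+ (m + n) * t = 0.
    by move=> e m; rewrite exprD -mulrA e mulr0.
  have Si : two_sided_ideal S.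
    apply: gwa_two_sided.
    - by exists 0%N; rewrite mulr0.
    - move=> s t [n en] [m em]; exists (m + n)%N.
      by rewrite mulrBr SX // addnC SX // subrr.
    - move=> b t [n en]; split; exists n.
        by rewrite mulrA XnC -mulrA en mulr0.
      by rewrite mulrA en mul0r.
    - move=> t [n en]; split; exists n; last by rewrite mulrA en mul0r.
      by rewrite mulrA -exprSr -add1n SX.
    - move=> t [n en]; split; [exists n.+1|exists n; by rewrite mulrA en mul0r].
      by rewrite exprSr -mulrA (mulrA X) XY mulrA XnC -mulrA en mulr0.
  have SY : S (Y * a%:C).
    by exists 1%N; rewrite expr1 mulrA XY -constM ua0 const0.
  have YN0 : Y * a%:C <> 0.
    move=> /(congr1 (coef^~ 1)).
    rewrite YC coef0 -[Y in LHS]expr1 (coef_Cgmon _ (Posz 1)) /= => a0.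
    by apply/aN0/(can_inj (autK alpha)); rewrite a0 alpha0.
  have [n] := simple_ideal1 Ts Si SY YN0; rewrite mulr1.
  case: n => [|n]; first exact: gwa_1_neq_0.
  move=> /(congr1 (coef^~ (Negz n))); rewrite (coef_gmon (Negz n)) eqxx coef0.
  by move/eqP; rewrite oner_eq0.
move=> [a [aN0 au0]].
pose S : set T := [set t | exists n, t * Y ^+ n = 0].
have SY n t : t * Y ^+ n = 0 -> forall m, t * Y ^+ (n + m) = 0.
  by move=> e m; rewrite exprD mulrA e mul0r.
(* Right multiplication by [b] preserves [S] because [b] can be carried to the right of a power of
   Y, using the inverse of [alpha]. *)
have YCV n b : b%:C * Y ^+ n = Y ^+ n * (iter n alphaV b)%:C.
  by rewrite YnC iter_alphaVK.
have Si : two_sided_ideal S.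
  apply: gwa_two_sided.
  - by exists 0%N; rewrite mul0r.
  - move=> s t [n en] [m em]; exists (n + m)%N.
    by rewrite mulrBl SY // addnC SY // subrr.
  - move=> b t [n en]; split; exists n.
      by rewrite -mulrA en mulr0.
    by rewrite -mulrA YCV mulrA en mul0r.
  - move=> t [n en]; split; [exists n; by rewrite -mulrA en mulr0|exists n.+1].
    by rewrite exprS -mulrA (mulrA X) XY YCV mulrA en mul0r.
  - move=> t [n en]; split; exists n; first by rewrite -mulrA en mulr0.
    by rewrite -mulrA -exprS -addn1 SY.
have SX : S (a%:C * X).
  by exists 1%N; rewrite expr1 -mulrA XY -constM au0 const0.
have XN0 : a%:C * X <> 0.
  move=> /(congr1 (coef^~ (Negz 0))).
  by rewrite coef0 -[X in LHS]expr1 (coef_Cgmon _ (Negz 0)) eqxx.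
have [n] := simple_ideal1 Ts Si SX XN0; rewrite mul1r.
move=> /(congr1 (coef^~ (Posz n))); rewrite (coef_gmon (Posz n)) eqxx coef0.
by move/eqP; rewrite oner_eq0.
Qed.
(* If alpha^m is conjugation by w^-1, the product N of the alpha^i(w), i < m,
   is alpha-invariant and alpha^(m^2) is conjugation by N^-1, so that
   N Y^(m^2) is central. *)
Lemma central_of_inner m : (1 <= m)%N -> inner (iter m alpha) ->
  exists N, (forall x, N * x = 0 -> x = 0) /\
    forall t : T, (N%:C * Y ^+ (m * m)) * t = t * (N%:C * Y ^+ (m * m)).
Proof.
move=> m0 [v [w [vw wv mE]]].
have wA a : w * iter m alpha a = a * w by rewrite mE !mulrA wv mul1r.
have ww : iter m alpha w = w by rewrite mE vw mul1r.
pose P k : A := \prod_(i < k) iter i alpha w.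
have PS k : P k.+1 = P k * iter k alpha w by rewrite /P big_ord_recr.
have P0 : P 0%N = 1 by rewrite /P big_ord0.
have wi i a : iter i alpha w * iter m alpha a = a * iter i alpha w.
  by rewrite -[a](iter_alphaVK i) iter_alphaAC -iter_alphaM wA iter_alphaM.
(* Each factor of [P k] absorbs one application of [iter m alpha]; the case [k = m] is the
   commutation of N Y^(m^2) with constants. *)
have PA k a : P k * iter (m * k) alpha a = a * P k.
  elim: k a => [|k IHk] a; first by rewrite P0 muln0 mul1r mulr1.
  by rewrite PS mulnS iterD -mulrA wi !mulrA IHk.
have wP k : w * P k = P k * w.
  elim: k => [|k IHk]; first by rewrite P0 mul1r mulr1.
  by rewrite PS -mulrA -wA iter_alphaAC ww !mulrA IHk.
have Pa : alpha (P m) = P m.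
  (* For [k = m] the right side is [P m * w = w * P m], and cancelling [w] gives the invariance. *)
  have aP k : w * alpha (P k) = P k.+1.
    elim: k => [|k IHk]; first by rewrite PS P0 alpha1 mulr1 mul1r.
    by rewrite [P k.+1 in LHS]PS alphaM mulrA IHk [RHS]PS.
  have := aP m; rewrite PS ww -wP => /(congr1 (fun x => v * x)).
  by rewrite !mulrA vw !mul1r.
have Preg k x : P k * x = 0 -> x = 0.
  elim: k x => [|k IHk] x; first by rewrite P0 mul1r.
  rewrite PS -mulrA => /IHk /(congr1 (fun x => iter k alpha v * x)).
  by rewrite mulrA -iter_alphaM vw iter_alpha1 mul1r mulr0.
exists (P m); split; first exact: Preg.
have [un _] := u_normal.
elim/gwa_gen_ind => [a|||s t IHs IHt|s t IHs IHt].
- by rewrite -mulrA YnC !mulrA -!constM PA.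
(* One Y is split off to meet X: the two products reduce to [gamma N * u] and [beta N * u] times
   Y^k, which agree since [N] is alpha-invariant. *)
- have [k kE] : exists k, (m * m = k.+1)%N.
    by exists (m * m).-1; rewrite prednK // muln_gt0 m0.
  rewrite kE [in LHS]exprSr -!mulrA YX YnC mulrA -constM -iterSr -kE PA un.
  rewrite kE exprS [RHS]mulrA XC -[in RHS]mulrA (mulrA X) XY mulrA -constM.
  by rewrite -[in RHS]Pa beta_alpha.
- by rewrite mulrA YC Pa -!mulrA -exprS -exprSr.
- by rewrite mulrDr mulrDl IHs IHt.
- by rewrite mulrA IHs -(mulrA s) IHt mulrA.
Qed.

Lemma outer_of_simple : simple_ring T ->
  forall m : nat, (1 <= m)%N -> outer (iter m alpha).
Proof.
move=> Ts m m0 /(central_of_inner m0) [N [Nreg zC]].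
have M0 : (0 < m * m)%N by rewrite muln_gt0 m0.
move: (m * m)%N M0 zC => M M0; set z := N%:C * _ => zC.
have z1N0 : 1 + z <> 0.
  move=> /(congr1 (coef^~ 0)).
  rewrite coefD coef1 (coef_Cgmon _ (Posz M)) coef0 ifF ?addr0.
    by move/eqP; rewrite oner_eq0.
  by case: M M0 {z zC}.
have Si : two_sided_ideal [set t | exists s, t = (1 + z) * s].
  split=> [|_ _ [s ->] [t ->]|b _ [s ->]] /=; first by exists 0; rewrite mulr0.
    by exists (s - t); rewrite mulrBr.
  split; last by exists (s * b); rewrite mulrA.
  by exists (b * s); rewrite !mulrA mulrDl mulrDr mul1r mulr1 zC.
have Sz : exists s, 1 + z = (1 + z) * s by exists 1; rewrite mulr1.
have [s s1] := simple_ideal1 Ts Si Sz z1N0.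
(* Compare coefficients in [1 = (1 + z) * s]; finiteness of the support of [s] will contradict the
   equation at [n = 0]. *)
have cs n : (n == 0)%:R = coef s n + N * coef (Y ^+ M * s) n.
  by rewrite -coef1 s1 mulrDl mul1r coefD -mulrA coefCM.
have [B sB] := coef_finite s.
(* Vanishing descends by steps of [M] to degree 0, since [N] is left regular and [alpha]
   injective. *)
have s_pos k : coef s (Posz (k + M)) = 0 -> coef s (Posz k) = 0.
  move=> e; have := cs (Posz (k + M)).
  rewrite e add0r coefYnM_ge eqz_nat addn_eq0 (gtn_eqF M0) andbF => /esym/Nreg.
  elim: (M) => // p IHp /= e'; apply: IHp; apply: (can_inj (autK alpha)).
  by rewrite e' alpha0.
(* On the negative side vanishing ascends by steps of [M], up to degree [- M]. *)
have s_neg n : n < 0 -> coef s (n - M%:Z) = 0 -> coef s n = 0.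
  move=> n0 e; have := cs n; rewrite (lt_eqF n0).
  by have [w ->] := coefYnM M s n; rewrite e iter_alpha0 mul0r mulr0 addr0.
have s0 : coef s 0 = 0.
  have: forall j, coef s (Posz (j * M)) = 0 -> coef s 0 = 0.
    by elim=> // j IHj; rewrite mulSn addnC => /s_pos.
  by move/(_ B); apply; apply: (sB _ _).1; exact: leq_pmulr.
have sM : coef s (0 - M%:Z) = 0.
  have: forall j, coef s (0 - (j.+1 * M)%:Z) = 0 -> coef s (0 - M%:Z) = 0.
    elim=> [|j IHj]; first by rewrite mul1n.
    rewrite mulSn addnC PoszD opprD addrA => e; apply/IHj/s_neg => //.
    by rewrite sub0r oppr_lt0 ltz_nat muln_gt0.
  (* [Negz k] is [- k.+1], so the starting index has [k = (B.+1 * M).-1], which is still at least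
     [B]. *)
  move/(_ B); apply; rewrite sub0r -[X in - X%:Z](@prednK (B.+1 * M));
    last by rewrite muln_gt0 M0.
  rewrite -NegzE; apply: (sB _ _).2; rewrite -ltnS prednK ?muln_gt0 //.
  exact: leq_pmulr.
have := cs 0; have [w ->] := coefYnM M s 0.
rewrite s0 sM iter_alpha0 mul0r mulr0 addr0.
by move/eqP; rewrite oner_eq0.
Qed.

(** * Sufficiency of the four conditions *)

Section Converse.
Hypothesis A_alpha_simple : alpha_simple alpha.
Hypothesis alpha_outer : forall m : nat, (1 <= m)%N -> outer (iter m alpha).
Hypothesis u_regular : regular_elt u.
Hypothesis u_comaximal : forall m : nat, (1 <= m)%N ->
  ideal_sum (principal_right_ideal u)
            (principal_right_ideal (iter m alpha u)) = [set: A].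

Lemma alpha_eq0 a : alpha a = 0 -> a = 0.
Proof. by move=> a0; apply: (can_inj (autK alpha)); rewrite a0 alpha0. Qed.

(** Each coefficient of [Y * t] is [alpha c] or [alpha (c * u)] with [c] a coefficient of [t], and
    [u] is not a right zero-divisor. *)
Lemma Y_lreg p t : Y ^+ p * t = 0 -> t = 0.
Proof.
elim: p t => [|p IHp] t; first by rewrite expr0 mul1r.
rewrite exprSr -mulrA => /IHp Yt; apply: coef_eq0 => n.
have := coefYM t (n + 1); rewrite Yt coef0 addrK.
case: ifP => _ /esym; first by rewrite mulr1; apply: alpha_eq0.
rewrite -alphaM => /alpha_eq0 e; apply: contrapT => cN0.
by have [_ []] := u_regular; exists (coef t n).
Qed.

(** Taking [p] beyond the X-degree of [t] turns every power of X into constants times powers of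
    Y. *)
Lemma Yn_mul_expansion t : exists p d (f : nat -> A),
  Y ^+ p * t = \sum_(i < d) (f i)%:C * Y ^+ i.
Proof.
have [p tp] := coef_finite t; exists p.
have [d /(_ d (leqnn _)) ->] := gwa_expansion (Y ^+ p * t).
exists d, (fun i => coef (Y ^+ p * t) (Posz i)); apply: eq_bigr => k _.
have [w ->] := coefYnM p t (Negz k).
rewrite NegzE -opprD -PoszD addSn -NegzE (tp _ _).2 ?leq_addl //.
by rewrite iter_alpha0 mul0r const0 mul0r addr0.
Qed.

(** * Polynomials in Y inside an ideal of T *)

Section Ideal.
Variable I : set T.
Hypothesis I_ideal : two_sided_ideal I.

(** Allowing an arbitrary shift [k] treats Y as invertible, as in the skew Laurent ring, without
    constructing the localization. *)
Definition shifted_mem d (f : nat -> A) : Prop :=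
  exists k, I (\sum_(i < d) (f i)%:C * Y ^+ (i + k)).

Lemma shifted_memB d f g : shifted_mem d f -> shifted_mem d g ->
  shifted_mem d (fun i => f i - g i).
Proof.
have [_ IB IM] := I_ideal.
have raise h k j : I (\sum_(i < d) (h i)%:C * Y ^+ (i + k)) ->
    I (\sum_(i < d) (h i)%:C * Y ^+ (i + (k + j))).
  move=> /(fun Ih => (IM (Y ^+ j) _ Ih).2); rewrite mulr_suml.
  by under eq_bigr do rewrite -mulrA -exprD -addnA.
move=> [k /raise Ik] [j /raise Ij]; exists (k + j)%N.
have := IB _ _ (Ik j) (Ij k); rewrite (addnC j) -sumrB.
by under eq_bigr do rewrite -mulrBl -constB.
Qed.

Lemma shifted_memCM d f b : shifted_mem d f ->
  shifted_mem d (fun i => b * f i).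
Proof.
have [_ _ IM] := I_ideal; move=> [k /(IM b%:C) [Ik _]]; exists k.
by move: Ik; rewrite mulr_sumr; under eq_bigr do rewrite mulrA -constM.
Qed.

(** Multiplying on the right by the preimage of [b] under [iter k alpha] cancels the twist due to
    the shift. *)
Lemma shifted_memMC d f b : shifted_mem d f ->
  shifted_mem d (fun i => f i * iter i alpha b).
Proof.
have [_ _ IM] := I_ideal.
move=> [k /(IM (iter k alphaV b)%:C) [_ Ik]]; exists k.
move: Ik; rewrite mulr_suml; under eq_bigr do
  rewrite -mulrA YnC iterD iter_alphaVK mulrA -constM.
by [].
Qed.

Lemma shifted_mem_alpha d f : shifted_mem d f ->
  shifted_mem d (fun i => alpha (f i)).
Proof.
have [_ _ IM] := I_ideal; move=> [k /(IM Y) [Ik _]]; exists k.+1.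
move: Ik; rewrite mulr_sumr; under eq_bigr do
  rewrite mulrA YC -mulrA -exprS -addnS.
by [].
Qed.

(* The argument that the skew Laurent ring A[Y, Y^-1] is simple, carried out
   on a nonzero "polynomial" f of least length d with a shift of it in I: by
   (i) f 0 can be taken to be 1, then f is alpha-invariant and
   b f_i = f_i alpha^i(b), so that a nonzero f_i is a unit which makes alpha^i
   inner. *)
Lemma Yn_in_ideal d f : shifted_mem d f -> (exists2 i, (i < d)%N & f i <> 0) ->
  exists k, I (Y ^+ k).
Proof.
elim: d f => [|d IHd] f fI [i id fi]; first by rewrite ltn0 in id.
have [[g [gI gN0]]|nog] := pselect (exists g, shifted_mem d g /\
    exists2 i, (i < d)%N & g i <> 0); first exact: IHd gI gN0.
have low g j : shifted_mem d.+1 g -> g 0%N = 0 -> (j <= d)%N -> g j = 0.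
  move=> [k Ik] g0; case: j => // j jd; apply: contrapT => gj; apply: nog.
  exists (g \o S); split; last by exists j.
  exists k.+1; move: Ik; rewrite big_ord_recl g0 const0 mul0r add0r.
  by under eq_bigr do rewrite /= /bump /= add1n addSnnS.
have high g j : shifted_mem d.+1 g -> g d = 0 -> (j <= d)%N -> g j = 0.
  move=> [k Ik] gd; rewrite leq_eqVlt => /orP[/eqP -> //|jd].
  apply: contrapT => gj; apply: nog; exists g; split; last by exists j.
  by exists k; move: Ik; rewrite big_ord_recr /= gd const0 mul0r addr0.
pose J : set A := [set a | exists2 g, shifted_mem d.+1 g & g 0%N = a].
have JE : J = [set: A].
  have /A_alpha_simple [|//] : alpha_ideal alpha J.
    split; last first.
      move=> _ [_ [g gI <-] <-]; exists (alpha \o g) => //.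
      exact: shifted_mem_alpha.
    split=> [|_ _ [g gI <-] [h hI <-]|b _ [g gI <-]].
    - exists (fun i => f i - f i); last exact: subrr.
      exact: shifted_memB.
    - exists (fun i => g i - h i) => //; exact: shifted_memB.
    - split; first by exists (fun i => b * g i) => //; exact: shifted_memCM.
      by exists (fun i => g i * iter i alpha b) => //; exact: shifted_memMC.
  move=> J0; case: fi; apply: low => //.
  have: J (f 0%N) by exists f.
  by rewrite J0.
have [h hI h0] : J 1 by rewrite JE.
have hb b j : (j <= d)%N -> b * h j = h j * iter j alpha b.
  move=> jd; apply/eqP; rewrite -subr_eq0; apply/eqP.
  apply: (low (fun j => b * h j - h j * iter j alpha b)) => //; last first.
    by rewrite h0 mulr1 mul1r subrr.
  by apply: shifted_memB; [exact: shifted_memCM|exact: shifted_memMC].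
have ha j : (j <= d)%N -> alpha (h j) = h j.
  move=> jd; apply/eqP; rewrite -subr_eq0; apply/eqP.
  apply: (low (fun j => alpha (h j) - h j)) => //; last first.
    by rewrite h0 alpha1 subrr.
  by apply: shifted_memB => //; exact: shifted_mem_alpha.
have hdN0 : h d <> 0.
  by move=> /(high h 0%N hI)/(_ (leq0n _))/eqP; rewrite h0 oner_eq0.
case: (posnP d) => [d0|d_gt0].
  have [k] := hI; rewrite d0 big_ord1 h0 const1 mul1r add0n => Ik.
  by exists k.
have itd b : iter d alpha (iter d alphaV b) = b by exact: iter_alphaVK.
(* The relation [hb] makes the right ideal of [h d] two-sided, and [ha] makes it alpha-stable; it is
   thus all of A, so [h d] has a right inverse. *)
have VE : [set h d * a | a in [set: A]] = [set: A].
  have /A_alpha_simple [|//] : alpha_ideal alpha [set h d * a | a in [set: A]].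
    split; last first.
      move=> _ [_ [a _ <-] <-]; exists (alpha a) => //.
      by rewrite alphaM (ha _ (leqnn d)).
    split=> [|_ _ [a _ <-] [b _ <-]|b _ [a _ <-]].
    - by exists 0 => //; rewrite mulr0.
    - by exists (a - b) => //; rewrite mulrBr.
    - split; last by exists (a * b) => //; rewrite mulrA.
      exists (iter d alpha b * a) => //.
      by rewrite mulrA -(hb _ _ (leqnn d)) mulrA.
  move=> V0; case: hdN0.
  have: [set h d * a | a in [set: A]] (h d) by exists 1 => //; rewrite mulr1.
  by rewrite V0.
have [w _ vw] : [set h d * a | a in [set: A]] 1 by rewrite VE.
have wv : iter d alphaV w * h d = 1 by rewrite (hb _ _ (leqnn d)) itd.
have ww : iter d alphaV w = w.
  by rewrite -[LHS]mulr1 -vw mulrA wv mul1r.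
rewrite ww in wv; case: (alpha_outer d_gt0); exists w, (h d); split=> // a.
by rewrite -mulrA (hb _ _ (leqnn d)) mulrA wv mul1r.
Qed.

(** Multiplying Y^(k+1) by X on the left and on the right gives [u] and [iter k.+1 alpha u] times
    Y^k; comaximality combines them into Y^k. *)
Lemma ideal1_of_Yn k : I (Y ^+ k) -> I 1.
Proof.
elim: k => [|k IHk]; first by rewrite expr0.
have [_ _ IM] := I_ideal; move=> IY; apply: IHk.
have Iu : I (u%:C * Y ^+ k) by rewrite -XY -mulrA -exprS; apply: (IM _ _ _).1.
have Iuk : I ((iter k.+1 alpha u)%:C * Y ^+ k).
  by rewrite iterSr -YnC -YX mulrA -exprSr; apply: (IM _ _ _).2.
have right (b a : A) : I (b%:C * Y ^+ k) -> I ((b * a)%:C * Y ^+ k).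
  move=> /(fun Ib => (IM (iter k alphaV a)%:C _ Ib).2).
  by rewrite -mulrA YnC iter_alphaVK mulrA -constM.
have : [set: A] 1 by [].
rewrite -(u_comaximal (ltn0Sn k)) => -[_ [_ [[a _ <-] [b _ <-] e]]].
rewrite -[Y ^+ k]mul1r -const1 e constD mulrDl.
by apply: two_sided_ideal_add => //; apply: right.
Qed.

End Ideal.

Lemma simple_of_conditions : simple_ring T.
Proof.
split; first exact: gwa_1_neq_0.
move=> I Ii; have [I0 _ IM] := Ii.
have [[t [It tN0]]|Iz] := pselect (exists t, I t /\ t <> 0); last first.
  left; apply/seteqP; split=> [x Ix|x ->] //=.
  by apply: contrapT => xN0; apply: Iz; exists x.
right; suff I1 : I 1.
  by apply/seteqP; split=> // s _; rewrite -[s]mulr1; apply: (IM _ _ _).1.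
have [p [d [f e]]] := Yn_mul_expansion t.
have [[i id fi]|fz] := pselect (exists2 i, (i < d)%N & f i <> 0); last first.
  case: tN0; apply: (@Y_lreg p); rewrite e big1 // => i _.
  have [->|fi] := pselect (f i = 0); first by rewrite const0 mul0r.
  by case: fz; exists i.
have fI : shifted_mem I d f.
  exists 0%N; under eq_bigr do rewrite addn0.
  by rewrite -e; apply: (IM _ _ _).1.
have [k Ik] := Yn_in_ideal Ii fI (ex_intro2 _ _ i id fi).
exact: ideal1_of_Yn Ii k Ik.
Qed.

End Converse.
End GWA.

Theorem theorem5p4 (F : fieldType) (A : algType F) (alpha gamma : algAut A)
    (alpha_gamma_comm : forall a : A, alpha (gamma a) = gamma (alpha a))
    (u : A) (u_normal : normal_elt gamma u) :
  simple_ring (gwa alpha gamma u) <->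
  [/\ alpha_simple alpha,
      forall m : nat, (1 <= m)%N -> outer (iter m alpha),
      regular_elt u
    & forall m : nat, (1 <= m)%N ->
        ideal_sum (principal_right_ideal u)
                  (principal_right_ideal (iter m alpha u)) = [set: A]].
Proof.
split=> [Ts|[]]; last exact: simple_of_conditions.
split.
- exact: alpha_simple_of_simple Ts.
- exact: outer_of_simple Ts.
- exact: regular_of_simple Ts.
- exact: comaximal_of_simple Ts.
Qed.
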